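(* Let $G_1$ be any non-trivial graph and let $G_2$ be any graph. Then the lexicographic product $G_1\circ G_2$ is hyperbolic if and only if $G_1$ is hyperbolic.
   Context: All graphs are simple and connected (possibly infinite) and every edge has length $1$. A graph $G$ is viewed as a geodesic metric space by identifying each edge isometrically with $[0,1]$; points of $G$ are its vertices and the interior points of its edges, and $d_G$ is the length of a shortest path. The trivial graph $E_1$ is the graph with a single vertex; a graph is non-trivial if it has at least two vertices. Lexicographic product $G_1\circ G_2$: vertex set $V(G_1)\times V(G_2)$; two distinct vertices $(u_1,v_1)$ and $(u_2,v_2)$ are adjacent if either $[u_1,u_2]\in E(G_1)$, or $u_1=u_2$ and $[v_1,v_2]\in E(G_2)$. A geodesic triangle $T=\{x_1,x_2,x_3\}$ in a geodesic metric space $X$ is the union of three geodesics $[x_1x_2],[x_2x_3],[x_3x_1]$. It is $\delta$-thin if every point of each side is at distance at most $\delta$ from the union of the other two sides. $X$ is $\delta$-hyperbolic if every geodesic triangle in $X$ is $\delta$-thin, and $X$ is hyperbolic if it is $\delta$-hyperbolic for some $\delta\ge 0$. *)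

(* Defs.v *)
From HB Require Import structures.
From mathcomp Require Import all_boot all_order all_algebra.
From mathcomp Require Import all_classical all_reals all_analysis.
From mathcomp Require Import ring.

Set Implicit Arguments.
Unset Strict Implicit.
Unset Printing Implicit Defensive.

Import Order.TTheory GRing.Theory Num.Theory.

Local Open Scope classical_set_scope.
Local Open Scope ring_scope.

(* Simple connected graphs. The vertex set is nonempty and may be infinite.
   A boolean adjacency relation on a choiceType loses no generality: with the
   classical axioms of MathComp-Analysis every type carries such structures
   and every relation is the reflection of a boolean one. *)
Record graph := Graph {
  vertex :> choiceType;
  adj : rel vertex;
  adj_sym : symmetric adj;
  adj_irr : irreflexive adj;
  vertex_nonempty : inhabited vertex;
  adj_connected : forall u v : vertex,
    exists2 p : seq vertex, path adj u p & last u p = v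
}.

Arguments adj {g}.

Definition nontrivial (G : graph) := exists u v : G, u != v.

Section LexicographicProduct.
Variables G1 G2 : graph.

(* The two vertices are automatically distinct, [adj] being irreflexive. *)
Definition lex_adj : rel (G1 * G2) :=
  fun x y => adj x.1 y.1 || (x.1 == y.1) && adj x.2 y.2.

Lemma lex_adj_sym : symmetric lex_adj.
Proof.
by move=> x y; rewrite /lex_adj adj_sym eq_sym (adj_sym x.2).
Qed.

Lemma lex_adj_irr : irreflexive lex_adj.
Proof. by move=> x; rewrite /lex_adj !adj_irr andbF. Qed.

Lemma lex_nonempty : inhabited (G1 * G2)%type.
Proof.
by case: (vertex_nonempty G1) (vertex_nonempty G2) => u [v]; exists; exact: (u, v).
Qed.

Lemma lex_connected (x y : G1 * G2) :
  exists2 p : seq (G1 * G2), path lex_adj x p & last x p = y.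
Proof.
case: x y => [u1 v1] [u2 v2].
have [p pp lp] := adj_connected v1 v2.
have [q pq lq] := adj_connected u1 u2.
exists (map (pair u1) p ++ map (fun u => (u, v2)) q).
  rewrite cat_path (last_map (pair u1)) lp.
  apply/andP; split.
    elim: p v1 pp {lp} => //= a p IHp v1 /andP[va pa].
    by rewrite /lex_adj /= eqxx va orbT IHp.
  elim: q u1 pq {lq} => //= a q IHq u1 /andP[ua qa].
  by rewrite /lex_adj /= ua IHq.
by rewrite last_cat (last_map (pair u1)) lp (last_map (fun u => (u, v2))) lq.
Qed.

Definition lexprod : graph :=
  Graph lex_adj_sym lex_adj_irr lex_nonempty lex_connected.

End LexicographicProduct.

Section Realization.
Variables (R : realType) (G : graph).

(* Barycentric coordinates of the point at distance t from u on the edge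
   [u, v], for t in [0, 1]; when u = v this is the vertex u. *)
Definition bary (u v : G) (t : R) : G -> R :=
  fun w => (1 - t) * (w == u)%:R + t * (w == v)%:R.

Definition is_vertex (x : G -> R) := exists v : G, x = bary v v 0.

Definition is_edge_point (x : G -> R) :=
  exists u v t, [/\ adj u v, 0 <= t <= 1 & x = bary u v t].

(* The points of G: its vertices and the points of its edges. Barycentric
   coordinates make the identifications [u, v] = [v, u] and the gluing of the
   edges along their common endpoints hold for Leibniz equality. *)
Record realization := Realization {
  coord :> G -> R;
  coordP : is_vertex coord \/ is_edge_point coord
}.

HB.instance Definition _ := gen_eqMixin realization.
HB.instance Definition _ := gen_choiceMixin realization.

(* [walk x y l]: some path from x to y, which is a concatenation of finitely
   many segments each contained in one edge, has length l. *)
Inductive walk : realization -> realization -> R -> Prop :=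
| walk_nil x : walk x x 0
| walk_cons (u v : G) (s t : R) (x y z : realization) (l : R) :
    adj u v -> 0 <= s <= 1 -> 0 <= t <= 1 ->
    coord x = bary u v s -> coord y = bary u v t ->
    walk y z l -> walk x z (`|s - t| + l).

Definition gdist (x y : realization) : R := inf [set l | walk x y l].

Lemma coord_inj (x y : realization) : coord x = coord y -> x = y.
Proof.
case: x y => [x px] [y py] /= e; move: px py; rewrite e => px py.
by congr Realization; exact: Prop_irrelevance.
Qed.

Lemma walk_ge0 x y l : walk x y l -> 0 <= l.
Proof. by elim=> // *; rewrite addr_ge0. Qed.

Lemma walk_seg (u v : G) s t (x y : realization) :
  adj u v -> 0 <= s <= 1 -> 0 <= t <= 1 ->
  coord x = bary u v s -> coord y = bary u v t -> walk x y `|s - t|.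
Proof.
move=> uv s01 t01 xe ye; rewrite -[`|_|]addr0.
exact: walk_cons uv s01 t01 xe ye (walk_nil y).
Qed.

Lemma walk_cat x y z l m : walk x y l -> walk y z m -> walk x z (l + m).
Proof.
move=> xy; elim: xy z m => [{}x|u v s t {}x y' {}y l' uv s01 t01 xe ye _ IH] z m.
  by rewrite add0r.
by move=> /IH yz; rewrite -addrA; exact: walk_cons uv s01 t01 xe ye yz.
Qed.

Lemma walk_rev x y l : walk x y l -> walk y x l.
Proof.
elim=> [{}x|u v s t {}x y' {}y l' uv s01 t01 xe ye _ IH]; first exact: walk_nil.
by rewrite addrC distrC; apply: walk_cat IH (walk_seg uv t01 s01 ye xe).
Qed.

Lemma bary_dist u v s t w : `|bary u v s w - bary u v t w| <= `|s - t|.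
Proof.
have -> : bary u v s w - bary u v t w
    = (s - t) * ((w == v)%:R - (w == u)%:R) by rewrite /bary; ring.
rewrite normrM ler_piMr//.
by case: (w == v); case: (w == u);
  rewrite ?subrr ?subr0 ?sub0r ?normrN ?normr0 ?normr1.
Qed.

Lemma walk_coord x y l (w : G) : walk x y l -> `|x w - y w| <= l.
Proof.
elim=> [{}x|u v s t {}x y' {}y l' uv s01 t01 xe ye _ IH].
  by rewrite subrr normr0.
rewrite -(subrKA (y' w)) (le_trans (ler_normD _ _))// lerD//.
by rewrite xe ye bary_dist.
Qed.

Lemma is_vertexP (v : G) : is_vertex (bary v v 0). Proof. by exists v. Qed.

Definition vpoint (v : G) : realization :=
  Realization (or_introl (is_vertexP v)).

Lemma bary0 u v : bary u v 0 = bary u u 0.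
Proof. by apply/funext => w; rewrite /bary; ring. Qed.

Lemma bary1 u v : bary u v 1 = bary v v 0.
Proof. by apply/funext => w; rewrite /bary; ring. Qed.

Lemma walk_to_vertex x : exists v l, walk x (vpoint v) l.
Proof.
case: (coordP x) => [[v xv]|[u [v [t [uv t01 xt]]]]].
  have -> : x = vpoint v by exact: coord_inj.
  by exists v, 0; exact: walk_nil.
exists u, `|t - 0|; apply: walk_seg uv t01 _ xt _; first by rewrite lexx ler01.
by rewrite bary0.
Qed.

Lemma walk_vertex (u v : G) : exists l, walk (vpoint u) (vpoint v) l.
Proof.
have [p] := adj_connected u v.
elim: p u => [u _ /= ->|a p IH u /= /andP[ua pa] lv]; first by exists 0; exact: walk_nil.
have [l al] := IH _ pa lv.
exists (`|0 - 1| + l); apply: walk_cons ua _ _ _ _ al; rewrite ?lexx ?ler01//=.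
  by rewrite bary0.
by rewrite bary1.
Qed.

Lemma walk_ex x y : exists l, walk x y l.
Proof.
have [u [l xu]] := walk_to_vertex x; have [v [m yv]] := walk_to_vertex y.
have [k uv] := walk_vertex u v.
exists (l + (k + m)); apply: walk_cat xu _; apply: walk_cat uv _.
exact: walk_rev.
Qed.

Lemma gdist_le x y l : walk x y l -> gdist x y <= l.
Proof. by move=> xyl; apply: ge_inf => //; exists 0 => m /walk_ge0. Qed.

Lemma le_gdist x y m : (forall l, walk x y l -> m <= l) -> m <= gdist x y.
Proof. by move=> h; apply: lb_le_inf => //; exact: walk_ex. Qed.

Lemma gdistxx x : gdist x x = 0.
Proof.
apply/le_anti; rewrite gdist_le/=; last exact: walk_nil.
by apply: le_gdist => l /walk_ge0.
Qed.

Lemma gdist_positivity x y : gdist x y = 0 -> x = y.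
Proof.
move=> xy0; apply/coord_inj/funext => w; apply/eqP; rewrite -subr_eq0.
rewrite -normr_le0 -xy0; apply: le_gdist => l; exact: walk_coord.
Qed.

Lemma gdist_sym x y : gdist x y = gdist y x.
Proof.
by rewrite /gdist; congr inf; apply/seteqP; split=> l /=; exact: walk_rev.
Qed.

Lemma gdist_triangle y x z : gdist x z <= gdist x y + gdist y z.
Proof.
rewrite -lerBlDr; apply: le_gdist => l xy.
rewrite lerBlDr addrC -lerBlDr; apply: le_gdist => m yz.
by rewrite lerBlDr addrC; exact: gdist_le (walk_cat xy yz).
Qed.

HB.instance Definition _ := @isMetric.Build R realization
  gdist gdistxx gdist_positivity gdist_sym gdist_triangle.

End Realization.

Section Hyperbolicity.
Variables (R : realType) (X : metricType R).

Definition geodesic (x y : X) (A : set X) :=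
  exists g : R -> X, [/\ g 0 = x, g (mdist x y) = y,
    {in `[0, mdist x y] &, forall s t, mdist (g s) (g t) = `|s - t|}
    & A = [set g t | t in `[0, mdist x y] ] ].

Definition near_side (delta : R) (A B C : set X) :=
  forall p, A p -> (edist_inf (B `|` C) p <= delta%:E)%E.

Definition delta_thin (delta : R) (A B C : set X) :=
  [/\ near_side delta A B C, near_side delta B C A & near_side delta C A B].

Definition delta_hyperbolic (delta : R) :=
  forall (x1 x2 x3 : X) (A B C : set X),
    geodesic x1 x2 A -> geodesic x2 x3 B -> geodesic x3 x1 C ->
    delta_thin delta A B C.

Definition hyperbolic := exists2 delta : R, 0 <= delta & delta_hyperbolic delta.

End Hyperbolicity.

(* Main.v *)
(** Both projecting the product to its first factor and including G1 as a slice
    u |-> (u, v0) change combinatorial distances by at most 2: a path of positive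
    length in G1 lifts to a path of the same length with prescribed second
    endpoint in the fibre, and two vertices of one fibre are at distance at most
    2 through a neighbouring fibre. Rounding points to nearby vertices turns
    these maps into maps of the geodesic spaces which distort distances by at
    most an additive constant. Hyperbolicity pulls back along such a map f: no
    Morse lemma is needed, since a point p of a geodesic [x, y] satisfies
    d(f x, f p) + d(f p, f y) <= d(f x, f y) + const, and in a hyperbolic space
    this alone puts f p near a geodesic [f x, f y]. *)

From mathcomp Require Import all_boot all_order all_algebra.
From mathcomp Require Import all_classical all_reals all_analysis.
From mathcomp Require Import ring lra.
Require Import Defs.

Set Implicit Arguments.
Unset Strict Implicit.
Unset Printing Implicit Defensive.

Import Order.TTheory GRing.Theory Num.Theory.

Local Open Scope classical_set_scope.
Local Open Scope ring_scope.

(** * Geodesics and thin triangles in a metric space *)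

Section Geodesics.
Variables (R : realType) (X : metricType R).
Implicit Types (x y p q : X) (A B C : set X).

Lemma geodesic_pointP x y A t : geodesic x y A -> 0 <= t <= mdist x y ->
  exists q, [/\ A q, mdist x q = t & mdist q y = mdist x y - t].
Proof.
move=> [g [g0 gd gi ->]] t0d.
have tin : t \in `[0, mdist x y] by rewrite in_itv.
exists (g t); split; first by exists t.
  by rewrite -[x in mdist x _]g0 gi ?in_itv/= ?lexx ?mdist_ge0// ler0_norm; lra.
by rewrite -[y in mdist _ y]gd gi ?in_itv/= ?lexx ?mdist_ge0// ler0_norm; lra.
Qed.

Lemma geodesic_mdist x y A p q : geodesic x y A -> A p -> A q ->
  mdist p q = `|mdist x p - mdist x q|.
Proof.
move=> [g [g0 gd gi ->]] [s /= s0 <-] [t /= t0 <-].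
rewrite gi// -[X in mdist X _]g0 -[X in _ - mdist X _]g0.
rewrite !gi ?in_itv/= ?lexx ?mdist_ge0// !sub0r !normrN.
by move: s0 t0; rewrite !in_itv/= => /andP[s0 _] /andP[t0 _]; rewrite (ger0_norm s0) (ger0_norm t0).
Qed.

Lemma geodesic_between x y A q : geodesic x y A -> A q ->
  mdist x q + mdist q y = mdist x y.
Proof.
move=> [g [g0 gd gi ->]] [t /= t0 <-].
rewrite -[X in mdist X _ + _]g0 -[X in _ + mdist _ X]gd.
rewrite !gi ?in_itv/= ?lexx ?mdist_ge0//.
by move: t0; rewrite in_itv/= => /andP[t0 td]; rewrite !ler0_norm; lra.
Qed.

(* The infimum need not be attained, hence the slack [1]. *)
Lemma near_side_ex delta A B C p : near_side delta A B C -> A p ->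
  exists2 z, (B `|` C) z & mdist p z < delta + 1.
Proof.
move=> near Ap.
have : (edist_inf (B `|` C) p < (delta + 1)%:E)%E.
  by rewrite (le_lt_trans (near _ Ap))// lte_fin ltrDl.
move=> /ereal_inf_lt[_ [z BCz <-]] /edist_lt_ball.
by rewrite ballEmdist; exists z.
Qed.

Lemma near_sideI delta A B C :
  (forall p, A p -> exists2 z, (B `|` C) z & mdist p z < delta) ->
  near_side delta A B C.
Proof.
move=> near p /near[z BCz pz]; apply: ge_ereal_inf.
exists (edist (p, z)); first by exists z.
apply: edist_fin; first by rewrite (le_lt_trans _ pz)// mdist_ge0.
by rewrite ballEmdist.
Qed.

(* The point [q] of a geodesic [p, x] at distance [E + delta + 2] from [p]
   cannot be close to [p, y], as that shortcut would make [x, y] too short;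
   thinness forces it to be close to [x, y]. *)
Lemma almost_between_near delta E x y p A B C :
  0 <= delta -> 0 <= E -> delta_hyperbolic X delta ->
  geodesic x y A -> geodesic y p B -> geodesic p x C ->
  mdist x p + mdist p y <= mdist x y + E ->
  exists2 q, A q & mdist p q < E + delta *+ 2 + 4.
Proof.
move=> d0 E0 hyp gA gB gC pE.
have [small|big] := leP (mdist p x) (E + delta + 2).
  have [|q [Aq xq _]] := geodesic_pointP gA (t := 0).
    by rewrite lexx mdist_ge0.
  exists q => //; have := metric_triangle p x q; rewrite xq; lra.
have [|q [Cq pq qx]] := geodesic_pointP gC (t := E + delta + 2).
  by apply/andP; split; lra.
have [_ _ near] := hyp _ _ _ _ _ _ gA gB gC.
have [z [Az|Bz] qz] := near_side_ex near Cq.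
  by exists z => //; have := metric_triangle p q z; rewrite pq; lra.
have yzp := geodesic_between gB Bz.
have := metric_triangle x q y; have := metric_triangle q z y.
have := metric_triangle p z q.
rewrite (metric_sym z q) (metric_sym x q) (metric_sym z y) (metric_sym p z).
move: pE; rewrite (metric_sym x p) (metric_sym p y); lra.
Qed.

End Geodesics.

(** * Pulling hyperbolicity back along a map with bounded additive distortion *)

Section RoughIsometry.
Variables (R : realType) (X Y : metricType R) (f : X -> Y) (C : R).
Hypothesis f_rough : forall x y, `|mdist (f x) (f y) - mdist x y| <= C.
Hypothesis f_geodesic : forall x y, exists A, geodesic (f x) (f y) A.

Let rough x y : mdist x y - C <= mdist (f x) (f y) <= mdist x y + C.
Proof. by have := f_rough x y; rewrite ler_norml; lra. Qed.

Let C_ge0 (x : X) : 0 <= C.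
Proof. exact: le_trans (f_rough x x). Qed.

(** Distorting the three distances among [x], [p], [y] costs [C] each, so [f p] is almost between
    [f x] and [f y] with error [3C]. *)
Lemma rough_isometry_near delta x y A A' p :
  0 <= delta -> delta_hyperbolic Y delta ->
  geodesic x y A -> geodesic (f x) (f y) A' -> A p ->
  exists2 q, A' q & mdist (f p) q < C *+ 3 + delta *+ 2 + 4.
Proof.
move=> d0 hyp gA gA' Ap.
have [B gB] := f_geodesic y p; have [D gD] := f_geodesic p x.
have C0 := C_ge0 x.
apply: (almost_between_near d0 _ hyp gA' gB gD); first lra.
have := geodesic_between gA Ap.
by have := rough x p; have := rough p y; have := rough x y; lra.
Qed.

(** Take [p] about as far from [x] as [q] is from [f x]. The point [q'] of [A'] near [f p] is then
    about as far from [f x] as [q], and on a geodesic this forces [q'] to be near [q]. *)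
Lemma rough_isometry_near_inv delta x y A A' q :
  0 <= delta -> delta_hyperbolic Y delta ->
  geodesic x y A -> geodesic (f x) (f y) A' -> A' q ->
  exists2 p, A p & mdist (f p) q < C *+ 8 + delta *+ 4 + 8.
Proof.
move=> d0 hyp gA gA' A'q.
have C0 := C_ge0 x.
have [p [Ap xp]] : exists p, A p /\ `|mdist (f x) q - mdist x p| <= C.
  have := geodesic_between gA' A'q; have := rough x y.
  have := mdist_ge0 q (f y); have := mdist_ge0 (f x) q => q0 q1 fxy q2.
  have [le|gt] := leP (mdist (f x) q) (mdist x y).
    have [|p [Ap xp _]] := geodesic_pointP gA (t := mdist (f x) q).
      by rewrite q0.
    by exists p; rewrite xp subrr normr0.
  (* Here [mdist (f x) q] overshoots [mdist x y], by at most [C], so the far end of [A] serves. *)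
  have [|p [Ap xp _]] := geodesic_pointP gA (t := mdist x y).
    by rewrite lexx mdist_ge0.
  by exists p; rewrite xp ler_norml; split=> //; lra.
exists p => //.
have [q' A'q' pq'] := rough_isometry_near d0 hyp gA gA' Ap.
have qq' := geodesic_mdist gA' A'q' A'q.
(* One [C] from the choice of [p], one from the distortion of [mdist x p], the rest from the bound
   on [mdist (f p) q']. *)
have : mdist q' q <= C *+ 5 + delta *+ 2 + 4.
  have := metric_triangle (f x) (f p) q'.
  have := metric_triangle (f x) q' (f p).
  have := rough x p; rewrite (metric_sym q' (f p)).
  move: xp; rewrite qq' !ler_norml; lra.
have := metric_triangle (f p) q' q; lra.
Qed.

Lemma rough_isometry_hyperbolic : hyperbolic Y -> hyperbolic X.
Proof.
move=> [delta d0 hyp].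
(* The chain [f p], [q], [q'], [f z] has steps below [3C + 2 delta + 4], [delta + 1] and
   [8C + 4 delta + 8]; returning to [X] adds [C]. The absolute value covers an empty [X], where [C]
   may be negative. *)
pose K : R := `|C| *+ 12 + delta *+ 7 + 13.
suff near (x1 x2 x3 : X) (A B D : set X) : geodesic x1 x2 A -> geodesic x2 x3 B ->
    geodesic x3 x1 D -> near_side K A B D.
  exists K; first by have := normr_ge0 C; rewrite /K; lra.
  by move=> x1 x2 x3 A B D gA gB gD; split;
    [apply: near gA gB gD|apply: near gB gD gA|apply: near gD gA gB].
move=> gA gB gD; apply: near_sideI => p Ap.
have CE : `|C| = C by rewrite ger0_norm// (C_ge0 p).
have [A' gA'] := f_geodesic x1 x2; have [B' gB'] := f_geodesic x2 x3.
have [D' gD'] := f_geodesic x3 x1.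
have [q A'q pq] := rough_isometry_near d0 hyp gA gA' Ap.
have [thin _ _] := hyp _ _ _ _ _ _ gA' gB' gD'.
have [q' BD'q' qq'] := near_side_ex thin A'q.
have [z BDz zq'] : exists2 z, (B `|` D) z &
    mdist (f z) q' < C *+ 8 + delta *+ 4 + 8.
  case: BD'q' => [B'q'|D'q'].
    have [z Bz zq'] := rough_isometry_near_inv d0 hyp gB gB' B'q'.
    by exists z => //; left.
  have [z Dz zq'] := rough_isometry_near_inv d0 hyp gD gD' D'q'.
  by exists z => //; right.
exists z => //; have := rough p z; have := metric_triangle (f p) q (f z).
have := metric_triangle q q' (f z); rewrite (metric_sym q' (f z)).
rewrite /K CE; move: pq qq' zq'; lra.
Qed.

End RoughIsometry.

(** * Combinatorial distance between vertices *)

Section PathDistance.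
Variable G : graph.
Implicit Types u v w : G.

Let is_path_length u v : pred nat :=
  fun n => `[< exists p : seq G, [/\ path adj u p, last u p = v & size p = n] >].

Let path_length_ex u v : exists n, is_path_length u v n.
Proof.
by have [p up pv] := adj_connected u v; exists (size p); apply/asboolP; exists p.
Qed.

Definition pathdist u v : nat := ex_minn (path_length_ex u v).

Lemma pathdistP u v :
  exists p : seq G, [/\ path adj u p, last u p = v & size p = pathdist u v].
Proof. by rewrite /pathdist; case: ex_minnP => n /asboolP. Qed.

Lemma pathdist_le u (p : seq G) : path adj u p -> (pathdist u (last u p) <= size p)%N.
Proof.
move=> up; rewrite /pathdist; case: ex_minnP => n _; apply.
by apply/asboolP; exists p.
Qed.

Lemma pathdistxx u : pathdist u u = 0.
Proof. by apply/eqP; rewrite -leqn0; exact: (@pathdist_le u [::]). Qed.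

Lemma pathdist_adj u v w : adj v w -> (pathdist u w <= (pathdist u v).+1)%N.
Proof.
move=> vw; have [p [up pv <-]] := pathdistP u v.
rewrite -(size_rcons p w) -[X in pathdist _ X](last_rcons u p w).
by apply: pathdist_le; rewrite rcons_path up pv.
Qed.

End PathDistance.

(** * Comparison of combinatorial and geodesic distance *)

Section VertexDistance.
Variables (R : realType) (G : graph).
Implicit Types (u v w : G) (x y : realization R G).

(* The affine extension of [h] to the realization is well defined. *)
Lemma bary_eval (h : G -> R) a b c d (s t : R) :
  bary a b s = bary c d t -> (1 - s) * h a + s * h b = (1 - t) * h c + t * h d.
Proof.
(* Both sides pair [h] with the same coordinate function; the sum runs over a finite list containing
   its support, as [G] may be infinite. *)
move=> st; pose S := undup [:: a; b; c; d].
have sumh v : v \in S -> \sum_(w <- S) (w == v)%:R * h w = h v.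
  move=> vS; rewrite (bigD1_seq v)//= ?undup_uniq// eqxx mul1r big1 ?addr0// => w.
  by move=> /negPf ->; rewrite mul0r.
have sumbary a' b' r : a' \in S -> b' \in S ->
    \sum_(w <- S) bary a' b' r w * h w = (1 - r) * h a' + r * h b'.
  move=> aS bS; rewrite -(sumh a')// -(sumh b')// !mulr_sumr -big_split/=.
  by apply: eq_bigr => w _; rewrite /bary; ring.
by rewrite -!sumbary ?st// mem_undup !inE eqxx ?orbT.
Qed.

(** On an edge the affine extension of [h] has slope at most 1 in absolute value; the variations add
    up along the walk. *)
Lemma walk_affine_lipschitz (h : G -> R) x y l a b c d (s t : R) :
  (forall u v, adj u v -> `|h u - h v| <= 1) ->
  walk x y l -> coord x = bary a b s -> coord y = bary c d t ->
  `|((1 - s) * h a + s * h b) - ((1 - t) * h c + t * h d)| <= l.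
Proof.
move=> h1 xyl; elim: xyl a b s.
  by move=> {}x a b s xe ye; rewrite (bary_eval h (etrans (esym xe) ye)) subrr normr0.
move=> u v s' t' {}x y' {}y l' uv _ _ xs yt _ IH a b s xe ye.
rewrite (bary_eval h (etrans (esym xe) xs)).
rewrite -(subrKA ((1 - t') * h u + t' * h v)) (le_trans (ler_normD _ _))// lerD//.
  rewrite (_ : _ - _ = (s' - t') * (h v - h u)); last by ring.
  by rewrite normrM ler_piMr// distrC h1.
exact: IH yt ye.
Qed.

Lemma vpoint_lipschitz (h : G -> R) u v :
  (forall u v, adj u v -> `|h u - h v| <= 1) ->
  `|h u - h v| <= gdist (vpoint R u) (vpoint R v).
Proof.
move=> h1; apply: le_gdist => l uvl.
have := walk_affine_lipschitz h1 uvl erefl erefl.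
by rewrite !subr0 !mul1r !mul0r !addr0.
Qed.

Lemma path_param (u : G) (p : seq G) : path adj u p ->
  exists g : R -> realization R G,
    [/\ g 0 = vpoint R u, g (size p)%:R = vpoint R (last u p)
      & forall s t, 0 <= s -> s <= t -> t <= (size p)%:R ->
          gdist (g s) (g t) <= t - s].
Proof.
elim: p u => [|a p IH] u /=.
  move=> _; exists (fun=> vpoint R u); split=> // s t _ st _.
  by rewrite gdistxx subr_ge0.
move=> /andP[ua /IH[g [g0 gp gl]]].
have [e ee] : exists e : R -> realization R G,
    forall t, 0 <= t <= 1 -> coord (e t) = bary u a t.
  have point t : exists x : realization R G, 0 <= t <= 1 -> coord x = bary u a t.
    have [t01|] := boolP (0 <= t <= 1); last by exists (vpoint R u).
    have ut : is_vertex (bary u a t) \/ is_edge_point (bary u a t).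
      by right; exists u, a, t.
    by exists (Realization ut).
  by have [e ee] := choice point; exists e.
have e0 : e 0 = vpoint R u by apply: coord_inj; rewrite ee ?lexx ?ler01// bary0.
have e1 : e 1 = vpoint R a by apply: coord_inj; rewrite ee ?lexx ?ler01// bary1.
have el s t : 0 <= s -> s <= t -> t <= 1 -> gdist (e s) (e t) <= t - s.
  move=> s0 st t1; rewrite -[leRHS]ger0_norm ?subr_ge0// distrC.
  apply: gdist_le; apply: (walk_seg ua); rewrite ?ee//; apply/andP; split=> //; lra.
pose f t := if t <= 1 then e t else g (t - 1).
(* The two branches agree at [t = 1], where both give the vertex [a]. *)
have f1 t : 1 <= t -> f t = g (t - 1).
  rewrite /f; case: ltgtP => // <- _; rewrite subrr g0 e1 //.
exists f; split.
- by rewrite /f ler01.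
- by rewrite f1 -natr1 ?addrK// lerDr.
move=> s t s0 st tp.
have [t1|/ltW t1] := leP t 1.
  by rewrite /f t1 (le_trans st t1) el.
have gt : gdist (vpoint R a) (g (t - 1)) <= t - 1.
  by rewrite -g0 -[leRHS]subr0 gl// ?subr_ge0// lerBlDr natr1.
have [s1|/ltW s1] := leP s 1.
  rewrite (f1 t)// /f s1 (le_trans (gdist_triangle (vpoint R a) _ _))//.
  by have := el s 1 s0 s1 (lexx _); rewrite e1; lra.
by rewrite !f1// (le_trans (gl _ _ _ _ _)) ?subr_ge0 ?lerBlDr ?natr1//; lra.
Qed.

(** A shortest path gives the upper bound; the lower one comes from the 1-Lipschitz function
    [pathdist u]. *)
Lemma gdist_vpoint u v : gdist (vpoint R u) (vpoint R v) = (pathdist u v)%:R.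
Proof.
apply/le_anti/andP; split.
  have [p [/path_param[g [g0 gp gl]] pv <-]] := pathdistP u v.
  by have := gl 0 (size p)%:R; rewrite g0 gp pv subr0; apply.
have := @vpoint_lipschitz (fun w => (pathdist u w)%:R) u v.
rewrite pathdistxx sub0r normrN normr_nat; apply => a b ab.
have := pathdist_adj u ab; have := @pathdist_adj _ u b a.
rewrite adj_sym -!(ler_nat R) -!natr1 => /(_ ab) ? ?.
by rewrite ler_norml; apply/andP; split; lra.
Qed.

(** Along a shortest path the parametrization is 1-Lipschitz and its ends are [size p] apart, so the
    triangle inequality leaves no slack. *)
Lemma geodesic_vpoint u v :
  exists A, @geodesic R (realization R G) (vpoint R u) (vpoint R v) A.
Proof.
have [p [/path_param[g [g0 gp gl]] pv pE]] := pathdistP u v.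
exists [set g t | t in `[0, (size p)%:R]%classic].
have dE : mdist (vpoint R u) (vpoint R v) = (size p)%:R.
  by rewrite pE; exact: gdist_vpoint.
exists g; rewrite dE; split=> //; first by rewrite gp pv.
move=> s t; rewrite !in_itv/=.
wlog st : s t / s <= t => [hw|/andP[s0 _] /andP[t0 tp]].
  have [st|/ltW ts] := leP s t; first exact: hw.
  by move=> sp tp; rewrite metric_sym distrC hw.
rewrite distrC ger0_norm ?subr_ge0//; apply/le_anti.
rewrite [_ <= _ - _]gl//=.
have := metric_triangle (g 0) (g s) (g (size p)%:R).
have := metric_triangle (g s) (g t) (g (size p)%:R).
have : mdist (g 0) (g s) <= s - 0 by apply: gl => //; lra.
have : mdist (g t) (g (size p)%:R) <= (size p)%:R - t by apply: gl.
rewrite g0 gp pv dE => ds dt tr1 tr2.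
change (gdist (g s) (g t)) with (mdist (g s) (g t)).
lra.
Qed.

Lemma near_vertex x : exists v, gdist x (vpoint R v) <= 1.
Proof.
case: (coordP x) => [[v xv]|[u [v [t [uv t01 xt]]]]].
  have -> : x = vpoint R v by exact: coord_inj.
  by exists v; rewrite gdistxx ler01.
exists u; apply: (@le_trans _ _ `|t - 0|).
  by apply/gdist_le/(walk_seg uv t01 _ xt); rewrite ?lexx ?ler01// bary0.
by rewrite subr0; case/andP: t01 => t0; rewrite ger0_norm.
Qed.

End VertexDistance.

(** Rounding moves each of two points by at most 1, whence the distortion [k + 2]. The rounded map
    takes values in vertices, between which geodesics exist. *)
Lemma hyperbolic_of_vertex_map (R : realType) (G H : graph) (f : G -> H) (k : nat) :
  (forall u v, (pathdist (f u) (f v) <= pathdist u v + k)%N) ->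
  (forall u v, (pathdist u v <= pathdist (f u) (f v) + k)%N) ->
  hyperbolic (realization R H) -> hyperbolic (realization R G).
Proof.
move=> fle fge; have [r rP] := choice (@near_vertex R G).
apply: (@rough_isometry_hyperbolic R (realization R G) (realization R H)
  (fun x => vpoint R (f (r x))) (k%:R + 2)) => x y; last exact: geodesic_vpoint.
have -> : mdist (vpoint R (f (r x))) (vpoint R (f (r y)))
  = (pathdist (f (r x)) (f (r y)))%:R by exact: gdist_vpoint.
have := fle (r x) (r y); have := fge (r x) (r y).
rewrite -!(ler_nat R) !natrD -[(pathdist (r x) (r y))%:R]gdist_vpoint.
rewrite [mdist x y]/(gdist x y).
have := gdist_triangle (vpoint R (r x)) x y.
have := gdist_triangle (vpoint R (r y)) (vpoint R (r x)) y.
have := gdist_triangle x (vpoint R (r x)) (vpoint R (r y)).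
have := gdist_triangle y x (vpoint R (r y)).
have := rP x; have := rP y.
rewrite (gdist_sym (vpoint R (r x)) x) (gdist_sym (vpoint R (r y)) y).
by rewrite ler_norml; lra.
Qed.

(** * Distances in the lexicographic product *)

Section LexDistance.
Variables G1 G2 : graph.
Hypothesis G1_nontrivial : nontrivial G1.
Implicit Types x y : lexprod G1 G2.

Lemma nontrivial_adj (u : G1) : exists v, adj u v.
Proof.
have [a [b ab]] := G1_nontrivial.
have [v uv] : exists v, u != v.
  by have [ua|] := eqVneq u a; [exists b; rewrite ua|exists a].
have [[|w p]/=] := adj_connected u v; first by move=> _ uv'; rewrite uv' eqxx in uv.
by move=> /andP[uw _] _; exists w.
Qed.

Lemma pathdist_fst x y : (pathdist x.1 y.1 <= pathdist x y)%N.
Proof.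
have [p [xp <- <-]] := pathdistP x y.
elim/last_ind: p xp => [|p z IH]; first by rewrite pathdistxx.
rewrite rcons_path last_rcons size_rcons => /andP[/IH {}IH].
case/orP => [/(pathdist_adj x.1) le|/andP[/eqP <- _]]; first exact: leq_trans le _.
exact: leqW.
Qed.

(** The first edge of [p] may already switch the second coordinate to [v], which then stays
    constant. *)
Lemma pathdist_lex_path x (p : seq G1) (v : G2) : path adj x.1 p -> p != [::] ->
  (pathdist x (last x.1 p, v) <= size p)%N.
Proof.
move=> xp p0; pose q : seq (lexprod G1 G2) := map (fun u => (u, v)) p.
have -> : (last x.1 p, v) = last x q.
  by case: p p0 {xp} @q => //= a p _; rewrite (last_map (fun u => (u, v))).
rewrite -(size_map (fun u => (u, v) : lexprod G1 G2) p) pathdist_le//.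
elim: p x xp {p0} @q => //= a p IH x /andP[xa ap].
by rewrite /lex_adj/= xa/=; exact: (IH (a, v)).
Qed.

Lemma pathdist_lex_le x y : (pathdist x y <= pathdist x.1 y.1 + 2)%N.
Proof.
have [[|a p] [xp py <-]] := pathdistP x.1 y.1; last first.
  have := @pathdist_lex_path x (a :: p) y.2 xp isT.
  by rewrite py -surjective_pairing => /leq_trans; apply; rewrite leq_addr.
(* Both points lie in one fibre: go to a neighbouring fibre and back, in two steps. *)
have [w xw] := nontrivial_adj x.1.
have := @pathdist_lex_path x [:: w; x.1] y.2.
rewrite /= xw adj_sym xw => /(_ isT isT).
by rewrite [X in (X, _)]py -surjective_pairing.
Qed.

End LexDistance.

Theorem theorem3p18 (R : realType) (G1 G2 : graph) (hG1 : nontrivial G1) :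
  hyperbolic (realization R (lexprod G1 G2)) <-> hyperbolic (realization R G1).
Proof.
split.
  have [v0] := vertex_nonempty G2.
  apply: (@hyperbolic_of_vertex_map R G1 (lexprod G1 G2) (fun u => (u, v0)) 2) => u v.
    exact: (@pathdist_lex_le _ _ hG1 (u, v0) (v, v0)).
  exact: leq_trans (@pathdist_fst G1 G2 (u, v0) (v, v0)) (leq_addr _ _).
apply: (@hyperbolic_of_vertex_map R (lexprod G1 G2) G1 fst 2) => x y.
  exact: leq_trans (pathdist_fst x y) (leq_addr _ _).
exact: pathdist_lex_le.
Qed.
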